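(* Let $a,b$ be integers with $b\ge 2$ and $1\le a\le b-1$, and let $(X,\mathcal{B},\mu,T)$ be the generalized del Junco–Rudolph map with parameters $a,b$. Then $T$ is totally rank one: for every integer $q\ge 1$, the transformation $T^{q}$ of $(X,\mathcal{B},\mu)$ is rank one.
   Context: Generalized del Junco–Rudolph map. Fix integers $b\ge 2$ and $1\le a\le b-1$. Define finite words over the alphabet $\{0,1\}$ recursively by $B_0=0$ and $B_{k+1}=(B_k)^{a b^{k}}\,1\,(B_k)^{(b-a)b^{k}}$ for $k\ge 0$, where $W^{n}$ denotes the concatenation of $n$ copies of $W$ (so $B_1=0^{a}10^{b-a}$). Let $X\subset\{0,1\}^{\mathbb{Z}}$ be the set of all $x=(x_i)_{i\in\mathbb{Z}}$ such that every finite block $x_m x_{m+1}\cdots x_{m+l-1}$ ($m\in\mathbb{Z}$, $l\ge1$) occurs as a block of consecutive letters in some $B_k$. Let $T:X\to X$ be the left shift, $(Tx)_i=x_{i+1}$, and let $\mathcal{B}$ be the $\sigma$-algebra generated by the cylinder sets. The measure $\mu$. For a finite word $\beta$, let $d_k(\beta)$ be the asymptotic density of occurrences of $\beta$ in the periodic bi-infinite sequence $\cdots B_kB_kB_k\cdots$, and let $d(\beta)=\lim_{k\to\infty}d_k(\beta)$ (this limit exists). $\mu$ is the shift-invariant Borel probability measure on $X$ determined by $\mu(\{x\in X: x_j\cdots x_{j+l-1}=\beta\})=d(\beta)$ for every word $\beta$ of length $l$ and every $j\in\mathbb{Z}$. Rank one. A measure-preserving transformation $S$ of a probability space $(X,\mathcal{B},\mu)$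 is rank one if for every finite measurable partition $P$ of $X$ and every $\varepsilon>0$ there are a measurable set $F$ and an integer $h\ge1$ such that $F,SF,\dots,S^{h-1}F$ are pairwise disjoint and every atom $A$ of $P$ satisfies $\mu(A\,\Delta\,A')<\varepsilon$ for some union $A'$ of sets among $F,SF,\dots,S^{h-1}F$ and possibly the complement of $\bigcup_{i=0}^{h-1}S^iF$, where that complement has measure less than $\varepsilon$. *)

(* Defs.v *)
From HB Require Import structures.
From mathcomp Require Import all_boot all_order all_algebra.
From mathcomp Require Import all_classical all_reals all_analysis.
From mathcomp Require Import zify.

Set Implicit Arguments.
Unset Strict Implicit.
Unset Printing Implicit Defensive.

Import Order.TTheory GRing.Theory Num.Theory.
Import numFieldNormedType.Exports.

Local Open Scope classical_set_scope.
Local Open Scope ring_scope.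

(* The letters 0 and 1 are [false] and [true]. *)
Definition word := seq bool.

Definition wpow (W : word) (n : nat) : word := flatten (nseq n W).

Fixpoint dJR_word (a b k : nat) : word :=
  if k is k'.+1 then
    wpow (dJR_word a b k') (a * b ^ k')
      ++ [:: true] ++ wpow (dJR_word a b k') ((b - a) * b ^ k')
  else [:: false].

Definition block (x : int -> bool) (m : int) (l : nat) : word :=
  mkseq (fun i => x (m + i%:Z)) l.

Definition dJR_set (a b : nat) : set (int -> bool) :=
  [set x | forall (m : int) (l : nat), (1 <= l)%N ->
     exists k, infix (block x m l) (dJR_word a b k)].

(* Measurable types are pointed in the library, so nonemptiness of
   [dJR_set a b] is proved first: the point is the sequence whose right half
   is the limit of the words B_k as prefixes of one another, and whose left
   half is their limit as suffixes. *)
Lemma wpowS W n : wpow W n.+1 = W ++ wpow W n.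
Proof. by []. Qed.

Lemma wpowSr W n : wpow W n.+1 = wpow W n ++ W.
Proof. by elim: n => [|n IH]; rewrite wpowS ?cats0// IH catA -wpowS -IH. Qed.

Lemma dJR_word_prefixS a b k : (1 <= a <= b - 1)%N ->
  prefix (dJR_word a b k) (dJR_word a b k.+1).
Proof.
move=> h /=; have : (0 < a * b ^ k)%N by rewrite muln_gt0 expn_gt0; lia.
by case: (a * b ^ k)%N => // n _; rewrite wpowS -catA prefix_prefix.
Qed.

Lemma dJR_word_suffixS a b k : (1 <= a <= b - 1)%N ->
  suffix (dJR_word a b k) (dJR_word a b k.+1).
Proof.
move=> h /=; have : (0 < (b - a) * b ^ k)%N by rewrite muln_gt0 expn_gt0; lia.
by case: ((b - a) * b ^ k)%N => // n _; rewrite wpowSr -cat_cons !catA suffix_suffix.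
Qed.

Lemma dJR_word_prefix a b k k' : (1 <= a <= b - 1)%N -> (k <= k')%N ->
  prefix (dJR_word a b k) (dJR_word a b k').
Proof.
move=> h; elim: k' => [|k' IH]; first by rewrite leqn0 => /eqP ->; rewrite ?prefix_refl ?suffix_refl.
rewrite leq_eqVlt => /predU1P[->|]; [exact: prefix_refl|rewrite ltnS => /IH p].
exact: prefix_trans p (dJR_word_prefixS _ h).
Qed.

Lemma dJR_word_suffix a b k k' : (1 <= a <= b - 1)%N -> (k <= k')%N ->
  suffix (dJR_word a b k) (dJR_word a b k').
Proof.
move=> h; elim: k' => [|k' IH]; first by rewrite leqn0 => /eqP ->; rewrite ?prefix_refl ?suffix_refl.
rewrite leq_eqVlt => /predU1P[->|]; [exact: suffix_refl|rewrite ltnS => /IH p].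
exact: suffix_trans p (dJR_word_suffixS _ h).
Qed.

Lemma size_dJR_word_gt a b k : (1 <= a <= b - 1)%N ->
  (k < size (dJR_word a b k))%N.
Proof.
move=> h; elim: k => // k IH; apply: leq_ltn_trans IH _ => /=.
have : (0 < a * b ^ k)%N by rewrite muln_gt0 expn_gt0; lia.
case: (a * b ^ k)%N => // n _.
by rewrite wpowS !size_cat /= -addnA addnS addnS ltnS leq_addr.
Qed.

Lemma dJR_word_square a b k : (1 <= a <= b - 1)%N -> (0 < k)%N ->
  infix (dJR_word a b k ++ dJR_word a b k) (dJR_word a b k.+1).
Proof.
move=> h k0 /=; have : (1 < a * b ^ k)%N.
  have : (1 < b ^ k)%N by rewrite -[1%N](expn0 b) ltn_exp2l //; lia.
  by nia.
case: (a * b ^ k)%N => [|[|n]] // _.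
by rewrite !wpowS catA -catA prefix_infix.
Qed.

Lemma dJR_set_nonempty (a b : nat) : (1 <= a <= b - 1)%N ->
  exists x, x \in dJR_set a b.
Proof.
move=> h; pose B := dJR_word a b.
pose x (i : int) := match i with
  | Posz n => nth false (B n) n
  | Negz n => nth false (rev (B n)) n end.
exists x; apply/mem_set => m l _.
pose k := (absz m + l).+1; exists k.+1.
apply: infix_trans (dJR_word_square h (ltn0Sn _)); rewrite -/k -/(B k).
have kB : (k < size (B k))%N := size_dJR_word_gt k h.
have xpos n : (n <= k)%N -> x (Posz n) = nth false (B k) n.
  move=> nk; have /prefixP[s e] := dJR_word_prefix h nk.
  by rewrite /= /B e nth_cat size_dJR_word_gt.
have xneg n : (n <= k)%N -> x (Negz n) = nth false (B k) (size (B k) - n.+1).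
  move=> nk; have /suffixP[s e] := dJR_word_suffix h nk.
  rewrite -nth_rev; last by apply: leq_ltn_trans nk kB.
  by rewrite /= /B e rev_cat nth_cat size_rev size_dJR_word_gt.
have -> : block x m l = take l (drop (absz ((size (B k))%:Z + m)) (B k ++ B k)).
  apply: (@eq_from_nth _ false).
    by rewrite size_mkseq size_takel // size_drop size_cat; lia.
  move=> i; rewrite size_mkseq => il.
  rewrite nth_mkseq // nth_take // nth_drop nth_cat.
  have [mi|mi] := leP 0 (m + i%:Z).
    have -> : m + i%:Z = Posz (absz (m + i%:Z)) by lia.
    rewrite xpos; last by lia.
    by rewrite ifF; [congr nth; lia|lia].
  have -> : m + i%:Z = Negz (absz (m + i%:Z)).-1 by lia.
  rewrite xneg; last by lia.
  by rewrite ifT; [congr nth; lia|lia].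
exact: infix_trans (infix_take _ _) (infix_drop _ _).
Qed.

(* The hypothesis [ha] is a parameter of the type of points because it is what
   makes the type nonempty. *)
Definition dJR_point (a b : nat) (ha : (1 <= a <= b - 1)%N) : Type :=
  set_type (dJR_set a b).

HB.instance Definition _ a b (ha : (1 <= a <= b - 1)%N) :=
  Choice.copy (dJR_point ha) (set_type (dJR_set a b)).

HB.instance Definition _ a b (ha : (1 <= a <= b - 1)%N) :=
  isPointed.Build (dJR_point ha)
    (exist _ (projT1 (cid (dJR_set_nonempty ha)))
             (projT2 (cid (dJR_set_nonempty ha)))).

Definition cylinder a b (ha : (1 <= a <= b - 1)%N) (j : int) (beta : word) :
    set (dJR_point ha) :=
  [set x | block (val x) j (size beta) = beta].
Arguments cylinder {a b} ha j beta.

Definition cylinders a b (ha : (1 <= a <= b - 1)%N) : set (set (dJR_point ha)) :=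
  [set C | exists j beta, C = cylinder ha j beta].
Arguments cylinders {a b} ha.

Notation dJR_space ha := (g_sigma_algebraType (cylinders ha)).

Lemma block_shift (x : int -> bool) m l :
  block (fun i => x (i + 1)) m l = block x (m + 1) l.
Proof. by apply: eq_mkseq => i /=; rewrite addrAC. Qed.

Lemma dJR_set_shift a b (x : int -> bool) :
  x \in dJR_set a b -> (fun i => x (i + 1)) \in dJR_set a b.
Proof.
move=> /set_mem xX; apply/mem_set => m l l1; rewrite block_shift.
exact: xX.
Qed.

Definition dJR_map a b (ha : (1 <= a <= b - 1)%N) (x : dJR_space ha) :
    dJR_space ha :=
  exist _ (fun i => val x (i + 1)) (dJR_set_shift (valP x)).
Arguments dJR_map {a b} ha x.

(* Two-sided asymptotic density of a set of integers, through the windows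
   [-N, N]. *)
Definition density (R : realType) (E : int -> bool) : R :=
  limn (fun N : nat =>
    (\sum_(0 <= n < N.*2.+1) (E (n%:Z - N%:Z))%:R) / N.*2.+1%:R : R).

Definition dJR_periodic (a b k : nat) (i : int) : bool :=
  nth false (dJR_word a b k) (absz (i %% (size (dJR_word a b k))%:Z)%Z).

Definition dJR_freq_at (R : realType) (a b k : nat) (beta : word) : R :=
  density R (fun i => block (dJR_periodic a b k) i (size beta) == beta).

Definition dJR_freq (R : realType) (a b : nat) (beta : word) : R :=
  limn (fun k => dJR_freq_at R a b k beta).

Definition measure_preserving d (X : measurableType d) (R : realType)
    (mu : probability X R) (S : X -> X) : Prop :=
  measurable_fun setT S /\
  forall A : set X, measurable A -> mu (S @^-1` A) = mu A.

(* The values on cylinders determine the measure; invariance is a consequence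
   of them, kept as part of the description. *)
Definition is_dJR_measure (R : realType) a b (ha : (1 <= a <= b - 1)%N)
    (mu : probability (dJR_space ha) R) : Prop :=
  measure_preserving mu (dJR_map ha) /\
  forall (j : int) (beta : word),
    mu (cylinder ha j beta) = (dJR_freq R a b beta)%:E.

Definition level (X : Type) (S : X -> X) (F : set X) (i : nat) : set X :=
  iter i S @` F.

(* A finite partition is a finite family of pairwise disjoint measurable sets
   covering the space; an empty member is harmless, being approximated by the
   empty union. The approximating set is the union of the levels indexed by
   [J], together with the complement of the tower when [c] holds. *)
Definition rank_one d (X : measurableType d) (R : realType)
    (mu : probability X R) (S : X -> X) : Prop :=
  measure_preserving mu S /\
  forall (n : nat) (P : 'I_n -> set X) (eps : R),
    (forall i, measurable (P i)) ->
    trivIset setT P ->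
    \bigcup_i P i = setT ->
    0 < eps ->
    exists (F : set X) (h : nat),
      let residual := ~` \bigcup_(i in `I_h) level S F i in
      [/\ measurable F,
          (1 <= h)%N,
          trivIset `I_h (level S F),
          (mu residual < eps%:E)%E &
          forall i : 'I_n, exists (J : set nat) (c : bool),
            J `<=` `I_h /\
            (mu (P i `+` ((\bigcup_(j in J) level S F j)
                          `|` (if c then residual else set0))) < eps%:E)%E].

(* Main.v *)
Require Import Defs.
From mathcomp Require Import all_boot all_order all_algebra.
From mathcomp Require Import all_classical all_reals all_analysis.
From mathcomp Require Import zify ring lra.

(** Write h_k for the length of B_k, so that h_{k+1} = b^{k+1} h_k + 1.

    A typical point looks, on long windows, like a periodic repetition of
    B_{k+1}; on such windows T acts as the rotation of Z/h_{k+1}, and T^q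
    splits that cycle into d = gcd(h_{k+1}, q) orbits, the classes mod d.  The
    difficulty is that d may stay larger than 1 for every k, while a single
    T^q-tower has to fill the space.  The way out is that h_k is coprime to
    h_{k+1}, hence to d: the shifts by 0, h_k, ..., (d-1) h_k represent all
    the classes mod d, and B_{k+1} is almost invariant under a shift by h_k,
    being made of two runs of copies of B_k around one spacer.  So the d orbits
    started at these points read nearly the same letters, and gluing them
    together gives a T^q-tower of height h_{k+1}/d whose levels are unions of d
    levels of the B_{k+1}-tower, most of which carry the same letters on any
    fixed window.

    Levels are cylinders over B_{k+1}^M, placed around the origin, with
    M = 2q + 3 large enough for the window to contain everything that the tower
    meets.  Their disjointness (tower_cylinder_disjoint) rests on the
    primitivity of B_{k+1} (cyclic_nth_period): the number of zeros of B_k is a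
    power of b, and h_k is coprime to b.  That the tower fills the space
    (residual_lt) follows from a lower bound for the frequencies (dJR_freq_ge):
    the number of occurrences of a word inside B_k, divided by h_k + 1, is
    nondecreasing in k.  The matching upper bound holds because disjoint levels
    have total measure at most 1.

    Finally, the sets that the towers approximate better and better as k grows
    form a sigma-algebra (sigma_algebra_approximable), which contains the
    cylinders (cylinder_approximable), hence all measurable sets. *)

Set Implicit Arguments.
Unset Strict Implicit.
Unset Printing Implicit Defensive.

Import Order.TTheory GRing.Theory Num.Theory.
Import numFieldNormedType.Exports.

(** * Lengths and primitivity of the words *)

Lemma size_wpow W n : size (wpow W n) = (n * size W)%N.
Proof. by elim: n => // n IH; rewrite wpowS size_cat IH mulSn. Qed.

Lemma wpowD W m n : wpow W (m + n) = wpow W m ++ wpow W n.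
Proof. by elim: m => // m IH; rewrite addSn !wpowS IH catA. Qed.

Lemma count_wpow p W n : count p (wpow W n) = (n * count p W)%N.
Proof. by elim: n => // n IH; rewrite wpowS count_cat IH mulSn. Qed.

Definition cyclic_nth (W : word) (n : nat) : bool := nth false W (n %% size W).

Lemma cyclic_nthDM W n s : cyclic_nth W (n + s * size W) = cyclic_nth W n.
Proof. by rewrite /cyclic_nth addnC modnMDl. Qed.

Lemma nth_wpow W M n : (n < M * size W)%N ->
  nth false (wpow W M) n = cyclic_nth W n.
Proof.
elim: M n => // M IH n; rewrite mulSn => lt.
rewrite wpowS nth_cat; have [nW|nW] := ltnP n (size W).
  by rewrite /cyclic_nth modn_small.
by rewrite IH; [rewrite -(cyclic_nthDM _ _ 1) mul1n subnK|rewrite ltn_subLR].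
Qed.

Lemma dJR_param a b : (1 <= a <= b - 1)%N -> (1 < b)%N.
Proof. lia. Qed.

Lemma copies_sum a b k : (1 <= a <= b - 1)%N ->
  (a * b ^ k + (b - a) * b ^ k = b ^ k.+1)%N.
Proof. by move=> ha; rewrite -mulnDl expnS subnKC //; lia. Qed.

Lemma size_dJR_wordS a b k : (1 <= a <= b - 1)%N ->
  size (dJR_word a b k.+1) = (b ^ k.+1 * size (dJR_word a b k) + 1)%N.
Proof.
move=> ha; rewrite -(copies_sum k ha) /= !size_cat /= !size_wpow; lia.
Qed.

Lemma size_dJR_word_gt0 a b k : (1 <= a <= b - 1)%N ->
  (0 < size (dJR_word a b k))%N.
Proof. by move=> /(size_dJR_word_gt k); apply: leq_ltn_trans. Qed.

(** Only the letters 1 are inserted, so the zeros are multiplied by b^{k+1} at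
    each step. *)
Lemma count_false_dJR a b k : (1 <= a <= b - 1)%N ->
  exists e, count_mem false (dJR_word a b k) = (b ^ e)%N.
Proof.
move=> ha; elim: k => [|k [e IH]]; first by exists 0%N.
exists (k.+1 + e)%N; rewrite expnD -IH -(copies_sum k ha) /=.
by rewrite !count_cat /= !count_wpow; lia.
Qed.

Lemma coprime_size_dJR a b k : (1 <= a <= b - 1)%N ->
  coprime (size (dJR_word a b k)) b.
Proof.
move=> ha; case: k => [|k]; first exact: coprime1n.
by rewrite size_dJR_wordS // expnS -mulnA mulnC coprime_sym /coprime gcdnMDl gcdn1.
Qed.

Lemma coprime_size_zeros a b k : (1 <= a <= b - 1)%N ->
  coprime (size (dJR_word a b k)) (count_mem false (dJR_word a b k)).
Proof.
move=> ha; have [e ->] := count_false_dJR k ha.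
exact/coprimeXr/coprime_size_dJR.
Qed.

Lemma coprime_size_succ a b k : (1 <= a <= b - 1)%N ->
  coprime (size (dJR_word a b k)) (size (dJR_word a b k.+1)).
Proof. by move=> ha; rewrite size_dJR_wordS // /coprime gcdnMDl gcdn1. Qed.

Lemma sum_periodic (f : nat -> nat) g s : (forall n, f (n + g)%N = f n) ->
  (\sum_(0 <= n < s * g) f n = s * \sum_(0 <= n < g) f n)%N.
Proof.
move=> fP; elim: s => [|s IH]; first by rewrite big_geq.
rewrite mulSn (@big_cat_nat _ _ _ g) //=; last exact: leq_addr.
rewrite mulSn -[in X in (_ + X = _)%N](add0n g) big_addn addKn; congr addn.
by under eq_bigr do rewrite fP.
Qed.

Lemma sum_nth_count (W : word) :
  (\sum_(0 <= n < size W) (~~ cyclic_nth W n) = count_mem false W)%N.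
Proof.
rewrite -sum1_count (big_nth false) [RHS]big_mkcond /=.
rewrite big_nat [RHS]big_nat; apply: eq_bigr => n /andP[_ nW].
by rewrite /cyclic_nth modn_small //; case: nth.
Qed.

(** Coprimality of the length and of the number of zeros makes W primitive: a
    period w yields the period g = gcd(w, |W|), so |W| / g divides both the
    length and the number of zeros, and g = |W|. *)
Lemma cyclic_nth_period (W : word) w :
  (0 < size W)%N -> coprime (size W) (count_mem false W) ->
  (forall n, cyclic_nth W (n + w) = cyclic_nth W n) -> (size W %| w)%N.
Proof.
move=> W0 cop per; pose h := size W; pose g := gcdn w h.
have perM n u : cyclic_nth W (n + u * w) = cyclic_nth W n.
  by elim: u => [|u IH]; [rewrite addn0|rewrite mulSn addnCA addnC per].
have perg n : cyclic_nth W (n + g) = cyclic_nth W n.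
  have [u uh /dvdnP[v e]] := Bezoutl w W0.
  by rewrite -(perM _ u) -addnA /g gcdnC e cyclic_nthDM.
have eh : h = (h %/ g * g)%N by rewrite divnK // dvdn_gcdr.
have ez : count_mem false W =
    (h %/ g * \sum_(0 <= n < g) ~~ cyclic_nth W n)%N.
  rewrite -sum_nth_count -/h [in LHS]eh sum_periodic // => n.
  by rewrite perg.
have : (h %/ g %| gcdn h (count_mem false W))%N.
  by rewrite dvdn_gcd {2}eh ez !dvdn_mulr.
rewrite (eqP cop) dvdn1 => /eqP e1.
by rewrite -/h eh e1 mul1n dvdn_gcdl.
Qed.

(** * Occurrences of a word *)

(** Occurrences are counted inside W, without wrapping around, which makes the
    count superadditive for concatenation. *)
Definition occ (beta W : word) : nat :=
  count (fun p => prefix beta (drop p W)) (iota 0 (size W)).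

Lemma occ_le_size beta W : (occ beta W <= size W)%N.
Proof. by rewrite /occ -{2}(size_iota 0 (size W)) count_size. Qed.

Lemma count_iotaD a m n :
  count a (iota m n) = count (fun i => a (m + i)%N) (iota 0 n).
Proof. by rewrite -{1}[m]addn0 iotaDl count_map. Qed.

Lemma occ_cat beta U V : (occ beta U + occ beta V <= occ beta (U ++ V))%N.
Proof.
rewrite /occ size_cat iotaD count_cat leq_add //.
  apply: sub_count => p; have [pU|pU] := ltnP p (size U).
    by move=> /prefixP[s e]; rewrite drop_cat pU e -catA prefix_prefix.
  by rewrite (drop_oversize pU) prefixs0 => /eqP ->; rewrite prefix0s.
rewrite add0n [X in (_ <= X)%N]count_iotaD; apply/eq_leq; apply: eq_count => p /=.
by rewrite drop_cat ltnNge leq_addr /= addKn.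
Qed.

Lemma occ_catr beta U V : (occ beta V <= occ beta (U ++ V))%N.
Proof. by apply: leq_trans (occ_cat _ _ _); apply: leq_addl. Qed.

Lemma occ_wpow beta W n : (n * occ beta W <= occ beta (wpow W n))%N.
Proof.
elim: n => // n IH; rewrite wpowS mulSn.
by apply: leq_trans (occ_cat _ _ _); rewrite leq_add2l.
Qed.

Lemma occ_dJR_wordS a b k beta : (1 <= a <= b - 1)%N ->
  (b ^ k.+1 * occ beta (dJR_word a b k) <= occ beta (dJR_word a b k.+1))%N.
Proof.
move=> ha; rewrite -(copies_sum k ha) mulnDl /=.
apply: leq_trans (occ_cat _ _ _); apply: leq_add; first exact: occ_wpow.
by rewrite -cat1s; apply: leq_trans (occ_catr _ _ _); apply: occ_wpow.
Qed.

Lemma occ_prefix beta U V : (0 < size U)%N -> prefix beta (U ++ V) ->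
  (occ beta V < occ beta (U ++ V))%N.
Proof.
case: U => // x U _; rewrite /occ /= => ->; rewrite add1n ltnS.
rewrite (count_iotaD _ 1) size_cat iotaD count_cat.
apply: leq_trans (leq_addl _ _).
rewrite add0n [X in (_ <= X)%N]count_iotaD; apply/eq_leq; apply: eq_count => q /=.
by rewrite add0n drop_cat ltnNge leq_addr /= addKn.
Qed.

Lemma occ_wpow_ge W M n : (0 < size W)%N -> (0 < M)%N ->
  (n <= occ (wpow W M) (wpow W n) + M)%N.
Proof.
move=> W0 M0; have [nM|nM] := leqP M n; last by lia.
suff H p : (p < occ (wpow W M) (wpow W (p + M)))%N.
  by have := H (n - M)%N; rewrite subnK //; lia.
elim: p => [|p IH].
  rewrite add0n -[X in occ _ X]cats0; apply: leq_ltn_trans (occ_prefix _ _) => //.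
    by rewrite size_wpow muln_gt0 M0.
  exact: prefix_prefix.
rewrite addSn wpowS; apply: leq_ltn_trans IH (occ_prefix _ _) => //.
by rewrite -wpowS -addSn addnC wpowD prefix_prefix.
Qed.

Lemma occ_wpow_dJR a b k M : (1 <= a <= b - 1)%N -> (0 < M)%N ->
  (b ^ k.+1 <= occ (wpow (dJR_word a b k) M) (dJR_word a b k.+1) + 2 * M)%N.
Proof.
move=> ha M0; rewrite -(copies_sum k ha) /=.
set B := dJR_word a b k; have B0 : (0 < size B)%N := size_dJR_word_gt0 k ha.
have := occ_wpow_ge (a * b ^ k) B0 M0.
have := occ_wpow_ge ((b - a) * b ^ k) B0 M0.
have := occ_cat (wpow B M) (wpow B (a * b ^ k)) (true :: wpow B ((b - a) * b ^ k)).
have := occ_catr (wpow B M) [:: true] (wpow B ((b - a) * b ^ k)).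
rewrite cat1s; lia.
Qed.

(** The count over one period of the bi-infinite repetition of W, which
    exceeds the inner count by at most the length of the word. *)
Definition cyclic_occ (beta W : word) : nat :=
  (\sum_(0 <= n < size W)
     (mkseq (fun i => cyclic_nth W (n + i)) (size beta) == beta))%N.

Lemma cyclic_block W n l : (n + l <= size W)%N ->
  mkseq (fun i => cyclic_nth W (n + i)) l = take l (drop n W).
Proof.
move=> nl; apply: (@eq_from_nth _ false).
  by rewrite size_mkseq size_takel // size_drop; lia.
move=> i; rewrite size_mkseq => il; rewrite nth_mkseq // nth_take // nth_drop.
by rewrite /cyclic_nth modn_small //; lia.
Qed.

Lemma occ_sum beta W :
  occ beta W = (\sum_(0 <= n < size W) prefix beta (drop n W))%N.
Proof.
by rewrite /occ -sum1_count big_mkcond /index_iota subn0 /=; apply: eq_bigr => n _; case: prefix.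
Qed.

Lemma occ_le_cyclic beta W : (occ beta W <= cyclic_occ beta W)%N.
Proof.
rewrite occ_sum /cyclic_occ big_nat [X in (_ <= X)%N]big_nat; apply: leq_sum => n /andP[_ nW].
case: (boolP (prefix _ _)) => // pf.
have sz : (size beta <= size W - n)%N by rewrite -size_drop; exact: size_prefix pf.
rewrite cyclic_block; last by lia.
by move: pf; rewrite prefixE => ->.
Qed.

Lemma cyclic_le_occ beta W : (cyclic_occ beta W <= occ beta W + size beta)%N.
Proof.
have H n : (n < size W)%N ->
   ((mkseq (fun i => cyclic_nth W (n + i)) (size beta) == beta) <=
   prefix beta (drop n W) + (size W - n <= size beta))%N.
  move=> nW; have [lt|ge] := ltnP (size W - n) (size beta).
    by rewrite (ltnW lt); case: eqP; lia.
  by rewrite cyclic_block; [rewrite prefixE leq_addr|lia].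
rewrite occ_sum /cyclic_occ.
apply: (@leq_trans (\sum_(0 <= n < size W) (prefix beta (drop n W) + (size W - n <= size beta))))%N.
  by rewrite big_nat [X in (_ <= X)%N]big_nat; apply: leq_sum => n /andP[_ /H].
rewrite big_split leq_add2l big_nat_rev /= add0n.
rewrite (@eq_big_nat _ _ _ _ _ _ (fun n => (n < size beta : nat))%N); last first.
  by move=> n /andP[_ nW]; congr nat_of_bool; lia.
elim: (size W) => [|n IH]; first by rewrite big_geq.
case: (ltnP n (size beta)) => nb.
  apply: (@leq_trans (\sum_(0 <= i < n.+1) 1)%N); last by rewrite sum_nat_const_nat; lia.
  by apply: leq_sum => i _; exact: leq_b1.
by rewrite big_nat_recr //= ltnNge nb addn0.
Qed.

(** * Near periodicity *)

Lemma leq_sum_bool (P : nat -> bool) m n : (\sum_(m <= i < n) P i <= n - m)%N.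
Proof.
apply: (@leq_trans (\sum_(m <= i < n) 1)%N); last by rewrite sum_nat_const_nat; lia.
by apply: leq_sum => i _; exact: leq_b1.
Qed.

(** A shift by |B_k| permutes the copies of B_k inside each of the two runs; it
    can only be detected in the last copy of each run and at the spacer. *)
Lemma sum_mismatch_dJR a b k (W := dJR_word a b k.+1)
    (h := size (dJR_word a b k)) : (1 <= a <= b - 1)%N ->
  (\sum_(0 <= v < size W) (cyclic_nth W (v + h) != cyclic_nth W v)
     <= 2 * h + 1)%N.
Proof.
move=> ha; set B := dJR_word a b k.
have h0 : (0 < h)%N := size_dJR_word_gt0 k ha.
pose n1 := (a * b ^ k)%N; pose n2 := ((b - a) * b ^ k)%N.
have n10 : (0 < n1)%N by rewrite muln_gt0 expn_gt0; lia.
have n20 : (0 < n2)%N by rewrite muln_gt0 expn_gt0; lia.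
have eW : W = wpow B n1 ++ true :: wpow B n2 by [].
have sW : size W = (n1 * h + (n2 * h).+1)%N by rewrite eW size_cat /= !size_wpow.
have hn1 : (h <= n1 * h)%N by rewrite leq_pmull.
have hn2 : (h <= n2 * h)%N by rewrite leq_pmull.
have nthl i : (i < n1 * h)%N -> cyclic_nth W i = cyclic_nth B i.
  move=> i1; rewrite {1}/cyclic_nth modn_small; last by rewrite sW; lia.
  by rewrite eW nth_cat size_wpow i1 nth_wpow.
have nthr i : (i < n2 * h)%N -> cyclic_nth W (n1 * h + i.+1) = cyclic_nth B i.
  move=> i1; rewrite {1}/cyclic_nth modn_small; last by rewrite sW; lia.
  by rewrite eW nth_cat size_wpow ltnNge leq_addr /= addKn /= nth_wpow.
have perB i : cyclic_nth B (i + h) = cyclic_nth B i.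
  by rewrite -[in RHS](cyclic_nthDM _ _ 1) mul1n.
rewrite (@big_cat_nat _ _ _ (n1 * h - h)) //=; last by lia.
rewrite (@big_cat_nat _ _ _ (n1 * h).+1 (n1 * h - h)) //=; [|lia..].
rewrite (@big_cat_nat _ _ _ (size W - h) (n1 * h).+1) //=; [|lia..].
rewrite big_nat big1 ?add0n; last first.
  by move=> i ilt; rewrite !nthl ?perB ?eqxx//; lia.
rewrite [X in (_ + (X + _) <= _)%N]big_nat [X in (_ + (X + _) <= _)%N]big1 ?add0n; last first.
  move=> i ilt.
  have -> : i = (n1 * h + (i - (n1 * h).+1).+1)%N by lia.
  by rewrite -addnA addSn !nthr ?perB ?eqxx//; lia.
apply: leq_trans (leq_add (leq_sum_bool _ _ _) (leq_sum_bool _ _ _)) _; lia.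
Qed.

Local Open Scope classical_set_scope.
Local Open Scope ring_scope.

(** * Frequencies of words *)

Lemma cvg_harmonic_bound (R : realType) (u : R^nat) (l C : R) :
  (forall n, `|u n - l| <= C * harmonic n) -> u @ \oo --> l.
Proof.
move=> ul; have cC : (fun n => C * harmonic n) @ \oo --> (0 : R).
  by rewrite -(mulr0 C); apply: cvgM; [exact: cvg_cst|exact: cvg_harmonic].
apply: (@squeeze_cvgr _ _ _ _ (fun n => l - C * harmonic n)
                              (fun n => l + C * harmonic n)).
- by apply: nearW => n; have := ul n; rewrite ler_distl.
- by rewrite -[X in _ --> X]subr0; apply: cvgB => //; exact: cvg_cst.
- by rewrite -[X in _ --> X]addr0; apply: cvgD => //; exact: cvg_cst.
Qed.

Lemma sum_periodic_shift (f : nat -> nat) g s : (forall n, f (n + g)%N = f n) ->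
  (\sum_(0 <= n < g) f (n + s) = \sum_(0 <= n < g) f n)%N.
Proof.
move=> fP; elim: s => [|s IH]; first by under eq_bigr do rewrite addn0.
case: g fP IH => [|g] fP IH; first by rewrite !big_geq.
rewrite -IH big_nat_recr //= [RHS]big_nat_recl //= addnC; congr addn.
  by rewrite add0n addnS addnC -addnS fP.
by apply: eq_bigr => i _; rewrite addnS addSn.
Qed.

(** The division-free form of: the average over L terms differs from the
    average over a period by at most h / L. *)
Lemma sum_periodic_bounds (f : nat -> nat) h L : (0 < h)%N ->
  (forall n, f n <= 1)%N -> (forall n, f (n + h)%N = f n) ->
  (L * (\sum_(0 <= n < h) f n) <= (\sum_(0 <= n < L) f n) * h + h * h)%N /\
  ((\sum_(0 <= n < L) f n) * h <= L * (\sum_(0 <= n < h) f n) + h * h)%N.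
Proof.
move=> h0 f1 fP; have le1 m n : (\sum_(m <= i < n) f i <= n - m)%N.
  apply: (@leq_trans (\sum_(m <= i < n) 1)%N); first exact: leq_sum.
  by rewrite sum_nat_const_nat muln1.
rewrite (@big_cat_nat _ _ _ (L %/ h * h)%N _ L) //=; last exact: leq_trunc_div.
rewrite sum_periodic //; have := le1 (L %/ h * h)%N L; have := le1 0%N h.
have := ltn_pmod L h0; have := divn_eq L h.
set c := (\sum_(0 <= n < h) _)%N; set r := (\sum_(_ <= n < L) _)%N.
move: (L %/ h)%N (L %% h)%N => s t -> th ch rt; rewrite subn0 in ch.
have {}rt : (r <= h)%N by lia.
split; nia.
Qed.

Lemma density_periodic (R : realType) (E : int -> bool) h : (0 < h)%N ->
  (forall i, E (i + h%:Z) = E i) ->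
  density R E = (\sum_(0 <= n < h) E n%:Z)%:R / h%:R.
Proof.
move=> h0 EP; pose c := (\sum_(0 <= n < h) E n%:Z)%N.
have EPM i s : E (i + (s * h)%:Z) = E i.
  elim: s i => [|s IH] i; first by rewrite mul0n addr0.
  by rewrite mulSn PoszD addrA IH EP.
apply/cvg_lim => //; apply: (@cvg_harmonic_bound _ _ _ h%:R) => N.
pose f n : nat := E (n%:Z - N%:Z).
have fP n : f (n + h)%N = f n by rewrite /f PoszD addrAC EP.
have fc : (\sum_(0 <= n < h) f n = c)%N.
  (* A shift by N h - N is a shift by - N modulo h, by a natural number. *)
  rewrite /c -(@sum_periodic_shift (fun n => E n%:Z : nat) h (N * h - N)) => [|n]; last first.
    by rewrite PoszD EP.
  apply: eq_bigr => n _; rewrite /f -[in LHS](EPM _ N); congr (nat_of_bool (E _)).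
  have : (N <= N * h)%N by rewrite leq_pmulr.
  lia.
have [] := @sum_periodic_bounds f h N.*2.+1 h0 (fun n => leq_b1 _) fP.
rewrite fc -natr_sum.
set S := (\sum_(0 <= n < _) f n)%N; set L := N.*2.+1.
rewrite -[X in X%:R / _ - _]/S.
have NL : N.+1%:R <= L%:R :> R by rewrite ler_nat /L; lia.
have L0 : (0 < L)%N by [].
move: S L L0 NL => S L L0 NL; rewrite -!(ler_nat R) !natrD !natrM => lo hi.
have hR : 0 < h%:R :> R by rewrite ltr0n.
have LR : 0 < L%:R :> R by rewrite ltr0n.
have NR : 0 < N.+1%:R :> R by rewrite ltr0n.
apply: (@le_trans _ _ (h%:R / L%:R)); last first.
  by rewrite /harmonic ler_wpM2l ?ler0n// lef_pV2.
have -> : S%:R / L%:R - c%:R / h%:R = (S%:R * h%:R - L%:R * c%:R) / (h%:R * L%:R) :> R.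
  by field; rewrite !gt_eqF.
rewrite normrM normfV (gtr0_norm (mulr_gt0 hR LR)) ler_pdivrMr ?mulr_gt0//.
rewrite mulrCA mulfVK ?gt_eqF// ler_norml; apply/andP; split; lra.
Qed.

Lemma dJR_freq_atE (R : realType) a b k beta : (1 <= a <= b - 1)%N ->
  dJR_freq_at R a b k beta =
    (cyclic_occ beta (dJR_word a b k))%:R / (size (dJR_word a b k))%:R.
Proof.
move=> ha; rewrite /dJR_freq_at.
have perE (i : nat) : dJR_periodic a b k i%:Z = cyclic_nth (dJR_word a b k) i.
  by rewrite /dJR_periodic modz_nat absz_nat.
rewrite (density_periodic _ (size_dJR_word_gt0 k ha)) => [|i].
  congr (_%:R / _); apply: eq_bigr => n _; congr (nat_of_bool (_ == _)).
  by apply: eq_mkseq => i; rewrite -PoszD perE.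
congr (_ == _); apply: eq_mkseq => n; rewrite addrAC /dJR_periodic.
by rewrite modzDr.
Qed.

(** By superadditivity and h_{k+1} + 1 <= b^{k+1} (h_k + 1), the ratios
    occ(beta, B_k) / (h_k + 1) are nondecreasing; they differ from the
    cyclic frequencies by O(1 / h_k), so both converge to the same limit. *)
Lemma dJR_freq_ge (R : realType) a b k beta : (1 <= a <= b - 1)%N ->
  (occ beta (dJR_word a b k))%:R / ((size (dJR_word a b k)).+1)%:R
    <= dJR_freq R a b beta.
Proof.
move=> ha; pose h k := size (dJR_word a b k).
pose e k : R := (occ beta (dJR_word a b k))%:R / (h k).+1%:R.
have hS n : ((h n.+1).+1 <= b ^ n.+1 * (h n).+1)%N.
  have : (1 < b ^ n.+1)%N by rewrite -[1%N](expn0 b) ltn_exp2l // (dJR_param ha).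
  by rewrite /h size_dJR_wordS //; nia.
have b0 n : (0 < b ^ n)%N by rewrite expn_gt0 (ltnW (dJR_param ha)).
have e_nd : nondecreasing_seq e.
  apply/nondecreasing_seqP => n; rewrite /e.
  rewrite ler_pdivrMr ?ltr0n// mulrAC ler_pdivlMr ?ltr0n// -!natrM ler_nat.
  have := occ_dJR_wordS n beta ha; have := hS n.
  move: (occ _ _) (occ _ _) => o o' Hh Ho.
  by apply: leq_trans (leq_mul (leqnn o') Hh) _; rewrite mulnA leq_mul2r mulnC Ho orbT.
have e_cvg : cvgn e.
  apply: nondecreasing_is_cvgn => //; exists 1 => _ [n _ <-].
  rewrite /e ler_pdivrMr ?ltr0n// mul1r ler_nat.
  by apply: leq_trans (occ_le_size _ _) _.
have -> : dJR_freq R a b beta = limn e; last exact: nondecreasing_cvgn_le.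
apply/cvg_lim => //; rewrite (_ : (fun _ => _) =
    e \+ (fun k => dJR_freq_at R a b k beta - e k)); last first.
  by apply/funext => n /=; rewrite addrC subrK.
rewrite -[X in _ --> X]addr0; apply: cvgD; first exact: e_cvg.
apply: (@cvg_harmonic_bound _ _ _ (size beta).+1%:R) => n.
rewrite subr0 dJR_freq_atE // /e -/(h n).
have := cyclic_le_occ beta (dJR_word a b n).
have := occ_le_cyclic beta (dJR_word a b n).
have := occ_le_size beta (dJR_word a b n); rewrite -/(h n).
move: (occ _ _) (cyclic_occ _ _) => o c; rewrite -!(ler_nat R) natrD => oh oc co.
have hn : n.+1%:R <= (h n)%:R :> R by rewrite ler_nat size_dJR_word_gt.
have n0 : 0 < n.+1%:R :> R by rewrite ltr0n.
have h0 : 0 < (h n)%:R :> R by apply: lt_le_trans hn.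
apply: (@le_trans _ _ ((size beta).+1%:R / (h n)%:R)); last first.
  by rewrite /harmonic ler_wpM2l// lef_pV2.
have o0 : 0 <= o%:R :> R by [].
move: h0 oh hn; rewrite -[(h n).+1]addn1 natrD -[(size beta).+1]addn1 natrD.
move: (h n)%:R (o%:R) (c%:R) ((size beta)%:R) o0 oc co => x y z l y0 yz zy x0 yx nx.
have -> : z / x - y / (x + 1) = (z - y + y / (x + 1)) / x.
  by field; rewrite !gt_eqF //; lra.
have y1 : 0 <= y / (x + 1) <= 1.
  by apply/andP; split; [rewrite divr_ge0|rewrite ler_pdivrMr]; lra.
rewrite normrM normfV (gtr0_norm x0) ler_wpM2r ?invr_ge0 ?(ltW x0)//.
by rewrite ger0_norm; lra.
Qed.

(** * Approximable sets *)

Lemma measure_cover2_lt d (X : measurableType d) (R : realType)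
    (mu : probability X R) (A B C : set X) (e1 e2 : R) :
  measurable A -> measurable B -> measurable C -> A `<=` B `|` C ->
  (mu B < e1%:E)%E -> (mu C < e2%:E)%E -> (mu A < (e1 + e2)%:E)%E.
Proof.
move=> mA mB mC ABC Be Ce.
apply: (@le_lt_trans _ _ (mu (B `|` C))).
  by rewrite le_measure ?inE//; exact: measurableU.
apply: (le_lt_trans (measureU2 _ mB mC)).
by rewrite EFinD; apply: lteD.
Qed.

Lemma measurable_symdiff d (X : measurableType d) (A B : set X) :
  measurable A -> measurable B -> measurable (A `+` B).
Proof. by move=> mA mB; apply: measurableU; apply: measurableD. Qed.

Lemma tail_measure_lt d (X : measurableType d) (R : realType)
    (mu : probability X R) (A : (set X)^nat) (eps : R) :
  (forall n, measurable (A n)) -> 0 < eps ->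
  exists N, (mu (\bigcup_n A n `\` \bigcup_(n in `I_N) A n) < eps%:E)%E.
Proof.
move=> mA e0; pose D N := \bigcup_n A n `\` \bigcup_(n in `I_N) A n.
have mD N : measurable (D N).
  by apply: measurableD; [exact: bigcupT_measurable|exact: bigcup_measurable].
have D0 : \bigcap_N D N = set0.
  rewrite -subset0 => x Dx; have [[n _ An] _] := Dx 0%N I.
  by have [_] := Dx n.+1 I; apply; exists n => /=.
have : mu \o D @ \oo --> 0%E.
  rewrite -(measure0 mu) -D0; apply: nonincreasing_cvg_mu => //.
  - by rewrite (le_lt_trans (probability_le1 _ _)) // ltry.
  - by rewrite D0.
  - move=> m n mn; apply/subsetPset => x [Ax nAx]; split => // -[i /= im Ai].
    by apply: nAx; exists i => //=; exact: leq_trans im mn.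
move=> /fine_cvgP[_ /cvgr_lt/(_ eps e0)][N _ HN]; exists N.
by have := HN N (leqnn _); rewrite /= -lte_fin fineK ?fin_num_measure//; exact: mD.
Qed.

(** The sets approximated, for all large k, by members of the k-th family. The
    quantifier on k allows different sets to be approximated by the same
    family. *)
Definition approximable d (X : measurableType d) (R : realType)
    (mu : probability X R) (E : nat -> set (set X)) : set (set X) :=
  [set A | measurable A /\ forall eps : R, 0 < eps ->
     \forall k \near \oo, exists2 U, E k U & (mu (A `+` U) < eps%:E)%E].

Lemma approximable_bigcup_fin d (X : measurableType d) (R : realType)
    (mu : probability X R) (E : nat -> set (set X)) (A : (set X)^nat) N :
  (forall k U, E k U -> measurable U) -> (forall k, E k set0) ->
  (forall k U V, E k U -> E k V -> E k (U `|` V)) ->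
  (forall n, approximable mu E (A n)) ->
  approximable mu E (\bigcup_(n in `I_N) A n).
Proof.
move=> mE E0 EU apA; elim: N => [|N [mN apN]].
  rewrite (_ : `I_0 = set0) ?bigcup_set0; last by apply/seteqP; split.
  split=> // eps e0; apply: nearW => k; exists set0 => //.
  by rewrite setYK measure0.
have -> : \bigcup_(n in `I_N.+1) A n = \bigcup_(n in `I_N) A n `|` A N.
  by rewrite !bigcup_mkord big_ord_recr.
have [mAN apAN] := apA N.
split; first exact: measurableU.
move=> eps e0; have e2 : 0 < eps / 2 by rewrite divr_gt0.
have := apAN _ e2; have := apN _ e2; apply: filterS2 => k [U EU1 U1] [V EV1 V1].
exists (U `|` V); first exact: EU.
have mU := mE _ _ EU1; have mV := mE _ _ EV1.
rewrite (splitr eps); apply: measure_cover2_lt U1 V1.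
- by apply: measurable_symdiff; apply: measurableU.
- exact: measurable_symdiff.
- exact: measurable_symdiff.
- move=> x /= [[[Ax|Ax] /not_orP[nU nV]]|[[Ux|Vx] /not_orP[nA nB]]].
  + by left; left.
  + by right; left.
  + by left; right.
  + by right; right.
Qed.

(** The families are closed under complement only up to a set of small
    measure, which is what a tower with a small residual provides. *)
Lemma sigma_algebra_approximable d (X : measurableType d) (R : realType)
    (mu : probability X R) (E : nat -> set (set X)) :
  (forall k U, E k U -> measurable U) -> (forall k, E k set0) ->
  (forall k U V, E k U -> E k V -> E k (U `|` V)) ->
  (forall eps : R, 0 < eps -> \forall k \near \oo, forall U, E k U ->
     exists2 V, E k V & (mu (~` U `+` V) < eps%:E)%E) ->
  sigma_algebra setT (approximable mu E).
Proof.
move=> mE E0 EU EC; split.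
- split=> // eps e0; apply: nearW => k; exists set0 => //.
  by rewrite setYK measure0.
- move=> A [mA apA]; rewrite setTD; split; first exact: measurableC.
  move=> eps e0; have e2 : 0 < eps / 2 by rewrite divr_gt0.
  have := apA _ e2; have := EC _ e2.
  apply: filterS2 => k Ck [U EkU AU]; have [V EkV UV] := Ck _ EkU.
  have mU := mE _ _ EkU; have mV := mE _ _ EkV.
  exists V => //; rewrite (splitr eps); apply: measure_cover2_lt AU UV.
  + by apply: measurable_symdiff => //; apply: measurableC.
  + exact: measurable_symdiff.
  + by apply: measurable_symdiff => //; apply: measurableC.
  + move=> x /= [[nA nV]|[Vx /contrapT Ax]]; have [Ux|nU] := pselect (U x).
    * by left; right.
    * by right; left.
    * by right; right; split.
    * by left; left.
- move=> A apA; have mA n : measurable (A n) by have [] := apA n.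
  have mUA : measurable (\bigcup_n A n) by exact: bigcupT_measurable.
  split=> // eps e0; have e2 : 0 < eps / 2 by rewrite divr_gt0.
  (* A finite union already carries all but eps / 2 of the measure. *)
  have [N AN] := tail_measure_lt mu mA e2.
  have [mN /(_ _ e2)] := approximable_bigcup_fin N mE E0 EU apA.
  apply: filterS => k [U EkU NU]; exists U => //; have mU := mE _ _ EkU.
  rewrite (splitr eps); apply: measure_cover2_lt AN NU.
  + exact: measurable_symdiff.
  + exact: measurableD.
  + exact: measurable_symdiff.
  + move=> x /= [[Ax nU]|[Ux nA]].
      have [Nx|nN] := pselect ((\bigcup_(n in `I_N) A n) x); first by right; left.
      by left.
    by right; right; split => // -[n _ An]; apply: nA; exists n.
Qed.

(** * Cylinders and the shift *)

Lemma measurable_cylinder a b (ha : (1 <= a <= b - 1)%N) j beta :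
  measurable (cylinder ha j beta : set (dJR_space ha)).
Proof. by apply: sub_sigma_algebra; exists j, beta. Qed.

Lemma cylinder_val a b (ha : (1 <= a <= b - 1)%N) j beta (x : dJR_space ha) n :
  cylinder ha j beta x -> (n < size beta)%N -> val x (j + n%:Z) = nth false beta n.
Proof. by move=> /= <-; rewrite size_mkseq => nb; rewrite nth_mkseq. Qed.

Lemma cylinder_intro a b (ha : (1 <= a <= b - 1)%N) j beta (x : dJR_space ha) :
  (forall n, (n < size beta)%N -> val x (j + n%:Z) = nth false beta n) ->
  cylinder ha j beta x.
Proof.
move=> H; apply: (@eq_from_nth _ false); rewrite size_mkseq // => n nb.
by rewrite nth_mkseq // H.
Qed.

Lemma val_iter_dJR_map a b (ha : (1 <= a <= b - 1)%N) n (x : dJR_space ha) i :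
  val (iter n (dJR_map ha) x) i = val x (i + n%:Z).
Proof.
elim: n i => [|n IH] i; first by rewrite addr0.
by rewrite iterS /= IH; congr (val x _); lia.
Qed.

(** Translations in both directions are needed: images of cylinders under the
    shift are cylinders because the shift is onto. *)
Lemma dJR_set_translate a b (x : int -> bool) (s : int) :
  x \in dJR_set a b -> (fun i => x (i + s)) \in dJR_set a b.
Proof.
move=> /set_mem xX; apply/mem_set => m l l1.
have [k] := xX (m + s) l l1; exists k.
by rewrite (_ : block _ m l = block x (m + s) l) //; apply: eq_mkseq => i; congr x; lia.
Qed.

Lemma image_cylinder a b (ha : (1 <= a <= b - 1)%N) n j beta :
  iter n (dJR_map ha) @` cylinder ha j beta = cylinder ha (j - n%:Z) beta.
Proof.
apply/seteqP; split=> [_ [x xC <-]|y yC].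
  apply: cylinder_intro => i ib; rewrite val_iter_dJR_map -(cylinder_val xC ib).
  by congr (val x _); lia.
pose x : dJR_space ha := 
  exist _ (fun i => val y (i - n%:Z)) (dJR_set_translate (- n%:Z) (valP y)).
exists x.
  apply: cylinder_intro => i ib; rewrite -(cylinder_val yC ib) /=.
  by congr (val y _); lia.
apply: val_inj; apply/funext => i; rewrite val_iter_dJR_map /=.
by rewrite addrK.
Qed.

Lemma measure_preserving_iter d (X : measurableType d) (R : realType)
    (mu : probability X R) (S : X -> X) n :
  measure_preserving mu S -> measure_preserving mu (iter n S).
Proof.
move=> [mS muS]; elim: n => [|n [mI muI]].
  by split=> //; exact: measurable_id.
split; first exact: measurableT_comp mS mI.
move=> A mA; rewrite (_ : iter n.+1 S @^-1` A = iter n S @^-1` (S @^-1` A)) //.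
rewrite muI ?muS //; rewrite -[X in measurable X]setTI.
exact: mS.
Qed.

(** * The towers *)

Definition tower_width a b q k : nat := gcdn (size (dJR_word a b k.+1)) q.

Definition tower_height a b q k : nat :=
  (size (dJR_word a b k.+1) %/ tower_width a b q k)%N.

(** The exponent leaves room for the shifts used by a tower, which are at most
    (2q + 1) |B_{k+1}|, and for one more period after the origin. *)
Definition tower_block a b q k : word := wpow (dJR_word a b k.+1) (2 * q + 3).

(** The first summand moves the origin one period into the window, so that the
    letters to the left of the origin are known as well. The second summand
    selects the class mod d, and the third moves up the tower. *)
Definition tower_shift a b q k m i : nat :=
  (size (dJR_word a b k.+1) + i * size (dJR_word a b k) + q * m)%N.

Definition tower_cylinder a b (ha : (1 <= a <= b - 1)%N) q k m i :
    set (dJR_space ha) :=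
  cylinder ha (- (tower_shift a b q k m i)%:Z) (tower_block a b q k).
Arguments tower_cylinder {a b} ha q k m i _.

Definition tower_level a b (ha : (1 <= a <= b - 1)%N) q k m :
    set (dJR_space ha) :=
  \bigcup_(i in `I_(tower_width a b q k)) tower_cylinder ha q k m i.
Arguments tower_level {a b} ha q k m _.

Lemma tower_width_gt0 a b q k : (0 < q)%N -> (0 < tower_width a b q k)%N.
Proof. by move=> q0; rewrite gcdn_gt0 q0 orbT. Qed.

Lemma tower_width_le a b q k : (0 < q)%N -> (tower_width a b q k <= q)%N.
Proof. by move=> q0; rewrite dvdn_leq // dvdn_gcdr. Qed.

Lemma tower_size a b q k :
  (tower_height a b q k * tower_width a b q k = size (dJR_word a b k.+1))%N.
Proof. by rewrite divnK // dvdn_gcdl. Qed.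

Lemma tower_height_gt0 a b q k : (1 <= a <= b - 1)%N -> (0 < tower_height a b q k)%N.
Proof.
move=> /(size_dJR_word_gt0 k.+1); rewrite -(tower_size a b q k).
by rewrite muln_gt0 => /andP[].
Qed.

Lemma measurable_tower_cylinder a b (ha : (1 <= a <= b - 1)%N) q k m i :
  measurable (tower_cylinder ha q k m i).
Proof. exact: measurable_cylinder. Qed.

Lemma measurable_tower_level a b (ha : (1 <= a <= b - 1)%N) q k m :
  measurable (tower_level ha q k m).
Proof. by apply: bigcup_measurable => i _; exact: measurable_tower_cylinder. Qed.

(** Moving up the tower by T^q translates the cylinders by q. *)
Lemma level_tower a b (ha : (1 <= a <= b - 1)%N) q k m :
  level (iter q (dJR_map ha)) (tower_level ha q k 0) m = tower_level ha q k m.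
Proof.
rewrite /level /tower_level image_bigcup; apply: eq_bigcupr => i _.
rewrite (_ : iter m _ = iter (m * q) (dJR_map ha)); last first.
  by apply/funext => x; rewrite iterM.
rewrite /tower_cylinder image_cylinder /tower_shift; congr (cylinder _ _ _); lia.
Qed.

Lemma size_dJR_word_le a b k : (1 <= a <= b - 1)%N ->
  (size (dJR_word a b k) <= size (dJR_word a b k.+1))%N.
Proof.
move=> ha; rewrite size_dJR_wordS // addn1 ltnW // ltnS leq_pmull //.
by rewrite expn_gt0 (ltnW (dJR_param ha)).
Qed.

Lemma tower_shift_le a b q k m i : (1 <= a <= b - 1)%N -> (0 < q)%N ->
  (m < tower_height a b q k)%N -> (i < tower_width a b q k)%N ->
  (tower_shift a b q k m i <= (2 * q + 1) * size (dJR_word a b k.+1))%N.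
Proof.
move=> ha q0 mH iw; rewrite /tower_shift.
have := size_dJR_word_le k ha; have := tower_width_le a b k q0.
have := tower_size a b q k; have := tower_width_gt0 a b k q0.
move: (size (dJR_word a b k.+1)) (size (dJR_word a b k)) => h h' w0 e wq hh.
have mh : (m <= h)%N by rewrite -e; nia.
have : (i * h' <= q * h)%N by apply: leq_mul => //; lia.
nia.
Qed.

Lemma tower_cylinder_val a b (ha : (1 <= a <= b - 1)%N) q k m i
    (x : dJR_space ha) (t : int) (h := size (dJR_word a b k.+1)) :
  (0 < q)%N -> (m < tower_height a b q k)%N -> (i < tower_width a b q k)%N ->
  tower_cylinder ha q k m i x -> - h%:Z <= t -> t <= h%:Z ->
  val x t = cyclic_nth (dJR_word a b k.+1)
              (absz (t + h%:Z) + i * size (dJR_word a b k) + q * m).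
Proof.
move=> q0 mH iw xC lt th; have h0 : (0 < h)%N := size_dJR_word_gt0 k.+1 ha.
have := tower_shift_le ha q0 mH iw; rewrite -/h => sh.
set n := (_ + _)%N; have en : t = - (tower_shift a b q k m i)%:Z + n%:Z.
  by rewrite /n /tower_shift -/h; lia.
have nb : (n < (2 * q + 3) * h)%N.
  have : (n <= h + tower_shift a b q k m i)%N by rewrite /n /tower_shift -/h; lia.
  nia.
by rewrite {1}en (cylinder_val xC) ?nth_wpow // size_wpow.
Qed.

Lemma coprime_height_step a b q k : (0 < q)%N ->
  coprime (tower_height a b q k) (q %/ tower_width a b q k).
Proof.
move=> q0; have w0 := tower_width_gt0 a b k q0.
rewrite /coprime -(eqn_pmul2r w0) mul1n muln_gcdl.
by rewrite tower_size divnK ?dvdn_gcdr.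
Qed.

Lemma tower_step_inj a b q k m m' : (0 < q)%N ->
  (m < tower_height a b q k)%N -> (m' < tower_height a b q k)%N ->
  q * m = q * m' %[mod size (dJR_word a b k.+1)] -> m = m'.
Proof.
move=> q0 mH mH'.
wlog le : m m' mH mH' / (m <= m')%N.
  by move=> hw e; have [le|/ltnW le] := leqP m m'; [|apply: esym]; apply: hw.
move=> /esym/eqP; rewrite eqn_mod_dvd; last by rewrite leq_mul2l le orbT.
have w0 := tower_width_gt0 a b k q0.
have qE : q = (q %/ tower_width a b q k * tower_width a b q k)%N.
  by rewrite divnK // dvdn_gcdr.
rewrite -mulnBr {1}qE -(tower_size a b q k) mulnAC dvdn_pmul2r //.
rewrite Gauss_dvdr; last exact: coprime_height_step.
case: (posnP (m' - m)) => [|pos /(dvdn_leq pos)]; lia.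
Qed.

(** Modulo d only the term i |B_k| survives, and |B_k| is coprime to d, which
    gives i; then q m modulo |B_{k+1}| determines m below |B_{k+1}| / d. *)
Lemma tower_shift_inj a b q k m i m' i' : (1 <= a <= b - 1)%N -> (0 < q)%N ->
  (m < tower_height a b q k)%N -> (i < tower_width a b q k)%N ->
  (m' < tower_height a b q k)%N -> (i' < tower_width a b q k)%N ->
  tower_shift a b q k m i = tower_shift a b q k m' i'
    %[mod size (dJR_word a b k.+1)] -> m = m' /\ i = i'.
Proof.
move=> ha q0 mH iw mH' iw'.
rewrite /tower_shift -!addnA !modnDl => e.
have wh : (tower_width a b q k %| size (dJR_word a b k.+1))%N by apply: dvdn_gcdl.
have wq : (tower_width a b q k %| q)%N by apply: dvdn_gcdr.
have ii : i = i'.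
  have : (i * size (dJR_word a b k) = i' * size (dJR_word a b k)
      %[mod tower_width a b q k])%N.
    have eqw n j : (j + q * n = j %[mod tower_width a b q k])%N.
      by rewrite -{1}(divnK wq) mulnAC addnC modnMDl.
    by rewrite -(eqw m) -[RHS](eqw m') -(modn_dvdm _ wh) e modn_dvdm.
  have cop : coprime (tower_width a b q k) (size (dJR_word a b k)).
    by apply: coprime_dvdl wh _; rewrite coprime_sym coprime_size_succ.
  wlog le : i i' iw iw' {e} / (i <= i')%N.
    move=> hw; have [le|/ltnW le] := leqP i i'; first exact: hw.
    by move=> /esym/(hw _ _ iw' iw le).
  move=> /esym/eqP; rewrite eqn_mod_dvd; last by rewrite leq_mul2r le orbT.
  rewrite -mulnBl Gauss_dvdl //.
  case: (posnP (i' - i)) => [|pos /(dvdn_leq pos)]; lia.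
split=> //; apply: (tower_step_inj q0 mH mH').
by apply/eqP; rewrite -(eqn_modDl (i * size (dJR_word a b k))) {2}ii e.
Qed.

(** A point in both cylinders reads powers of B_{k+1} at two places whose
    windows overlap by more than a period, so the distance between them is a
    period of B_{k+1}, hence a multiple of its length. *)
Lemma tower_cylinder_disjoint a b (ha : (1 <= a <= b - 1)%N) q k m i m' i'
    (x : dJR_space ha) : (0 < q)%N ->
  (m < tower_height a b q k)%N -> (i < tower_width a b q k)%N ->
  (m' < tower_height a b q k)%N -> (i' < tower_width a b q k)%N ->
  tower_cylinder ha q k m i x -> tower_cylinder ha q k m' i' x ->
  m = m' /\ i = i'.
Proof.
move=> q0 mH iw mH' iw'.
wlog le : m i m' i' mH iw mH' iw' /
    (tower_shift a b q k m i <= tower_shift a b q k m' i')%N.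
  move=> hw xC xC'; have [le|/ltnW le] := leqP (tower_shift a b q k m i) (tower_shift a b q k m' i').
    exact: hw.
  by have [-> ->] := hw _ _ _ _ mH' iw' mH iw le xC' xC.
(* It suffices that the difference of the two shifts is a period. *)
move=> xC xC'; apply: (tower_shift_inj ha q0 mH iw mH' iw').
apply/esym/eqP; rewrite eqn_mod_dvd //.
set W := dJR_word a b k.+1; set w := (_ - _)%N.
apply: cyclic_nth_period; [exact: size_dJR_word_gt0|exact: coprime_size_zeros|].
move=> n; have h0 : (0 < size W)%N := size_dJR_word_gt0 k.+1 ha.
have perW s : cyclic_nth W (s %% size W) = cyclic_nth W s by rewrite /cyclic_nth modn_mod.
rewrite -perW -modnDml perW -[RHS]perW.
have nh := ltn_pmod n h0; move: (n %% size W)%N nh => {}n nh.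
have := tower_shift_le ha q0 mH' iw'; rewrite -/W => sh.
have u1 : (size W <= tower_shift a b q k m i)%N by rewrite /tower_shift -addnA leq_addr.
have sb : size (tower_block a b q k) = ((2 * q + 3) * size W)%N by rewrite size_wpow.
have lt1 : (n < (2 * q + 3) * size W)%N by nia.
have wq : (w <= 2 * q * size W)%N by rewrite /w; nia.
have lt2 : (n + w < (2 * q + 3) * size W)%N.
  by rewrite -addSn (leq_trans (leq_add nh wq)) // -mulSn leq_mul2r; lia.
rewrite -!(@nth_wpow _ (2 * q + 3)) // -/(tower_block a b q k).
rewrite -(cylinder_val xC') ?sb // -(cylinder_val xC) ?sb //.
by congr (val x _); rewrite /w; lia.
Qed.

(** * Measure of the towers *)

Definition tower_union a b (ha : (1 <= a <= b - 1)%N) q k : set (dJR_space ha) :=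
  \bigcup_(m in `I_(tower_height a b q k)) tower_level ha q k m.
Arguments tower_union {a b} ha q k _.

Lemma measurable_tower_union a b (ha : (1 <= a <= b - 1)%N) q k :
  measurable (tower_union ha q k).
Proof. by apply: bigcup_measurable => m _; exact: measurable_tower_level. Qed.

Lemma measure_bigcup_const d (X : measurableType d) (R : realType)
    (mu : probability X R) (F : (set X)^nat) (c : R) n :
  (forall i, (i < n)%N -> measurable (F i)) -> trivIset `I_n F ->
  (forall i, (i < n)%N -> mu (F i) = c%:E) ->
  mu (\bigcup_(i in `I_n) F i) = (n%:R * c)%:E.
Proof.
move=> mF tF muF; rewrite bigcup_mkord measure_semi_additive_ord_I //; last first.
  by rewrite -bigcup_mkord; apply: bigcup_measurable.
rewrite (eq_bigr (fun=> c%:E)) => [|i _]; last exact: muF.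
by rewrite sumEFin sumr_const card_ord mulr_natl.
Qed.

(** The pairs (m, i) are enumerated as quotient and remainder by the width, so
    that the tower is a disjoint union of |B_{k+1}| cylinders of equal
    measure. *)
Lemma measure_tower_union (R : realType) a b (ha : (1 <= a <= b - 1)%N)
    (mu : probability (dJR_space ha) R) q k : is_dJR_measure mu -> (0 < q)%N ->
  mu (tower_union ha q k) =
    ((size (dJR_word a b k.+1))%:R * dJR_freq R a b (tower_block a b q k))%:E.
Proof.
move=> [_ mucyl] q0; set d := tower_width a b q k; set H := tower_height a b q k.
have d0 : (0 < d)%N by exact: tower_width_gt0.
pose F n := tower_cylinder ha q k (n %/ d) (n %% d).
have bd n : (n < size (dJR_word a b k.+1))%N -> (n %/ d < H)%N /\ (n %% d < d)%N.
  by rewrite -(tower_size a b q k) -/d -/H => nh; rewrite ltn_divLR // ltn_pmod.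
rewrite (_ : tower_union ha q k =
  \bigcup_(n in `I_(size (dJR_word a b k.+1))) F n); last first.
  apply/seteqP; split => [x [m /= mH [i /= iw xC]]|x [n /= nh xC]].
    exists (m * d + i)%N => /=.
      by rewrite -(tower_size a b q k) -/d -/H -[in X in (_ < X)%N](@subnK 1 H); nia.
    by rewrite /F divnMDl // divn_small // addn0 modnMDl modn_small.
  have [nH nd] := bd _ nh.
  by exists (n %/ d)%N => //; exists (n %% d)%N.
apply: measure_bigcup_const => [n _||n _]; [exact: measurable_tower_cylinder| |exact: mucyl].
move=> n n' nh nh' [x [xC xC']].
have [nH nd] := bd _ nh; have [nH' nd'] := bd _ nh'.
have [e1 e2] := tower_cylinder_disjoint q0 nH nd nH' nd' xC xC'.
by rewrite (divn_eq n d) e1 e2 -divn_eq.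
Qed.

Lemma dJR_freq_block_le (R : realType) a b (ha : (1 <= a <= b - 1)%N)
    (mu : probability (dJR_space ha) R) q k : is_dJR_measure mu -> (0 < q)%N ->
  (size (dJR_word a b k.+1))%:R * dJR_freq R a b (tower_block a b q k) <= 1.
Proof.
move=> hmu q0; rewrite -lee_fin -(measure_tower_union _ hmu q0).
by apply: probability_le1; exact: measurable_tower_union.
Qed.

(** The bound comes from the occurrences of the block inside B_{k+2} alone,
    where all but at most 2 (2q + 3) of the b^{k+2} copies of B_{k+1} start one. *)
Lemma dJR_freq_block_ge (R : realType) a b q k : (1 <= a <= b - 1)%N ->
  1 - (4 * q + 8)%:R / (b ^ k.+1)%:R <=
    (size (dJR_word a b k.+1))%:R * dJR_freq R a b (tower_block a b q k).
Proof.
move=> ha; set h := size _.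
have h0 : 0 < h%:R :> R by rewrite ltr0n size_dJR_word_gt0.
have := dJR_freq_ge R k.+2 (tower_block a b q k) ha.
rewrite size_dJR_wordS // -/h => freq_ge.
apply: le_trans (ler_wpM2l (ltW h0) freq_ge).
have b0 : (0 < b)%N by rewrite (ltnW (dJR_param ha)).
have := @occ_wpow_dJR a b k.+1 (2 * q + 3) ha; rewrite addn3 => /(_ isT).
rewrite -addn3 -/(tower_block a b q k).
have : (b ^ k.+1 <= b ^ k.+2)%N by rewrite leq_pexp2l.
have : (0 < b ^ k.+1)%N by rewrite expn_gt0 b0.
move: (occ _ _) (b ^ k.+2)%N (b ^ k.+1)%N => o p p' p'0 pp po.
have p0 : (0 < p)%N by apply: leq_trans pp.
have pR : 0 < p%:R :> R by rewrite ltr0n.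
have p'R : 0 < p'%:R :> R by rewrite ltr0n.
apply: (@le_trans _ _ (1 - (4 * q + 8)%:R / p%:R)).
  by rewrite lerD2l lerN2 ler_wpM2l ?ler0n// lef_pV2 // ler_nat.
have D0 : 0 < (p * h + 1).+1%:R :> R by rewrite ltr0n.
rewrite mulrA ler_pdivlMr // mulrBl mul1r.
have -> : (4 * q + 8)%:R / p%:R * (p * h + 1).+1%:R =
    (4 * q + 8)%:R * (h%:R + 2 / p%:R) :> R.
  by rewrite -[(p * h + 1).+1]addn1 -addnA natrD natrM; field; rewrite gt_eqF.
have hge1 : 1 <= h%:R :> R by rewrite ler1n -(ltr0n R).
have po' : p%:R <= o%:R + 2 * (2 * q%:R + 3) :> R.
  by move: po; rewrite -(ler_nat R) !(natrD, natrM).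
have q0 : 0 <= q%:R :> R by [].
have p2 : 0 <= 2 / p%:R :> R by rewrite divr_ge0.
rewrite -[(p * h + 1).+1]addn1 !(natrD, natrM).
move: (h%:R) (p%:R) (o%:R) (q%:R) (2 / p%:R) h0 po' q0 p2 hge1 => x y z s r x0 yz s0 r0 x1.
have xz : x * y <= x * (z + 2 * (2 * s + 3)) by rewrite ler_pM2l.
have sr : 0 <= s * r by rewrite mulr_ge0.
lra.
Qed.

Lemma near_expn_lt (R : realType) b (C eps : R) : (1 < b)%N -> 0 <= C -> 0 < eps ->
  \forall k \near \oo, C / (b ^ k.+1)%:R < eps.
Proof.
move=> b1 C0 e0.
have : (fun n => C * harmonic n) @ \oo --> (0 : R).
  by rewrite -(mulr0 C); apply: cvgM; [exact: cvg_cst|exact: cvg_harmonic].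
move=> /cvgr_lt/(_ _ e0); apply: filterS => k; apply: le_lt_trans.
rewrite ler_wpM2l // lef_pV2 ?posrE ?ltr0n ?expn_gt0 ?(ltnW b1)// ler_nat.
by apply: ltnW; exact: ltn_expl.
Qed.

Lemma residual_lt (R : realType) a b (ha : (1 <= a <= b - 1)%N)
    (mu : probability (dJR_space ha) R) q (eps : R) : is_dJR_measure mu -> (0 < q)%N ->
  0 < eps -> \forall k \near \oo, (mu (~` tower_union ha q k) < eps%:E)%E.
Proof.
move=> hmu q0 e0.
have := @near_expn_lt R b (4 * q + 8)%:R eps (dJR_param ha) (ler0n _ _) e0.
apply: filterS => k ke; rewrite probability_setC; last exact: measurable_tower_union.
rewrite measure_tower_union // -EFinB lte_fin; apply: le_lt_trans ke.
by have := dJR_freq_block_ge R q k ha; lra.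
Qed.

Lemma trivIset_tower_level a b (ha : (1 <= a <= b - 1)%N) q k : (0 < q)%N ->
  trivIset `I_(tower_height a b q k) (tower_level ha q k).
Proof.
move=> q0 m m' mH mH' [x [[i iw xC] [i' iw' xC']]].
by have [] := tower_cylinder_disjoint q0 mH iw mH' iw' xC xC'.
Qed.

(** * Approximation by levels *)

Definition mismatch a b k (n : nat) : bool :=
  let W := dJR_word a b k.+1 in
  cyclic_nth W (n + size (dJR_word a b k)) != cyclic_nth W n.

Lemma cyclic_nth_no_mismatch a b k n i :
  (forall i', (i' < i)%N -> ~~ mismatch a b k (n + i' * size (dJR_word a b k))) ->
  cyclic_nth (dJR_word a b k.+1) (n + i * size (dJR_word a b k)) =
  cyclic_nth (dJR_word a b k.+1) n.
Proof.
elim: i => [|i IH] H; first by rewrite addn0.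
rewrite mulSn addnCA addnC.
have := H i (ltnSn i); rewrite negbK => /eqP ->.
by apply: IH => i' ii; apply: H; exact: ltnW.
Qed.

(** Along the tower, the points w + q m are distinct modulo |B_{k+1}|, so each
    mismatch of B_{k+1} is met at most once. *)
Lemma sum_mismatch_orbit a b q k w : (1 <= a <= b - 1)%N -> (0 < q)%N ->
  (\sum_(m < tower_height a b q k) mismatch a b k (w + q * m)
    <= 3 * size (dJR_word a b k))%N.
Proof.
move=> ha q0; set h := size (dJR_word a b k.+1).
have h0 : (0 < h)%N := size_dJR_word_gt0 k.+1 ha.
have hk0 : (0 < size (dJR_word a b k))%N := size_dJR_word_gt0 k ha.
pose f (m : 'I_(tower_height a b q k)) : 'I_h :=
  Ordinal (ltn_pmod (w + q * m) h0).
have finj : injective f.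
  move=> m m' /(congr1 val) /= /eqP; rewrite eqn_modDl => /eqP e.
  exact/val_inj/(tower_step_inj q0 (ltn_ord m) (ltn_ord m') e).
have misE n : mismatch a b k (n %% h) = mismatch a b k n.
  by rewrite /mismatch /cyclic_nth modn_mod modnDml.
apply: (@leq_trans (\sum_(v < h) mismatch a b k v)); last first.
  rewrite -(big_mkord xpredT (fun v => mismatch a b k v : nat)).
  by apply: leq_trans (sum_mismatch_dJR k ha) _; lia.
rewrite (eq_bigr (fun m => mismatch a b k (f m) : nat)) => [|m _]; last by rewrite misE.
rewrite -(big_imset (fun v : 'I_h => mismatch a b k v : nat)) /=; last by move=> ? ? _ _ /finj.
by rewrite big_mkcond; apply: leq_sum => v _; case: ifP.
Qed.

(** Bounds from above the indicator of the levels on which the letters in the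
    window [j, j + l) depend on the cylinder i of the level. *)
Definition bad_level a b q k (j : int) (l m : nat) : nat :=
  (\sum_(s < l) \sum_(i < tower_width a b q k)
     mismatch a b k (absz (j + s%:Z + (size (dJR_word a b k.+1))%:Z)%R
       + q * m + i * size (dJR_word a b k)))%N.

Lemma sum_bad_level a b q k j l : (1 <= a <= b - 1)%N -> (0 < q)%N ->
  (\sum_(m < tower_height a b q k) bad_level a b q k j l m
    <= l * (q * (3 * size (dJR_word a b k))))%N.
Proof.
move=> ha q0; rewrite /bad_level exchange_big /=.
apply: (@leq_trans (\sum_(s < l) (q * (3 * size (dJR_word a b k)))%N)%N); last first.
  by rewrite sum_nat_const card_ord.
apply: leq_sum => s _; rewrite exchange_big /=.
apply: (@leq_trans (\sum_(i < tower_width a b q k) (3 * size (dJR_word a b k))%N)%N); last first.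
  by rewrite sum_nat_const card_ord leq_mul2r tower_width_le // orbT.
apply: leq_sum => i _; under eq_bigr do rewrite addnAC.
exact: sum_mismatch_orbit.
Qed.

Lemma good_level_val a b (ha : (1 <= a <= b - 1)%N) q k j l m (x : dJR_space ha) s :
  (0 < q)%N -> (absz j + l <= k)%N -> (m < tower_height a b q k)%N -> (s < l)%N ->
  bad_level a b q k j l m = 0%N -> tower_level ha q k m x ->
  val x (j + s%:Z) = cyclic_nth (dJR_word a b k.+1)
    (absz (j + s%:Z + (size (dJR_word a b k.+1))%:Z)%R + q * m).
Proof.
move=> q0 jl mH sl bad [i /= iw xC].
have kh : (k.+1 < size (dJR_word a b k.+1))%N := size_dJR_word_gt k.+1 ha.
rewrite (tower_cylinder_val q0 mH iw xC); [|lia..].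
rewrite addnAC; apply: cyclic_nth_no_mismatch => i' ii.
have iw' : (i' < tower_width a b q k)%N by exact: ltn_trans iw.
move/eqP: bad; rewrite /bad_level sum_nat_eq0 => /forallP /(_ (Ordinal sl)) /=.
by rewrite sum_nat_eq0 => /forallP /(_ (Ordinal iw')) /=; case: mismatch.
Qed.

Definition level_unions a b (ha : (1 <= a <= b - 1)%N) q (k : nat) :
    set (set (dJR_space ha)) :=
  [set U | exists2 J, J `<=` `I_(tower_height a b q k) &
                      U = \bigcup_(m in J) tower_level ha q k m].
Arguments level_unions {a b} ha q k _.

Lemma measure_tower_level_le (R : realType) a b (ha : (1 <= a <= b - 1)%N)
    (mu : probability (dJR_space ha) R) q k m : is_dJR_measure mu -> (0 < q)%N ->
  (mu (tower_level ha q k m) <= (q%:R / (size (dJR_word a b k.+1))%:R)%:E)%E.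
Proof.
move=> hmu q0; have h0 : 0 < (size (dJR_word a b k.+1))%:R :> R.
  by rewrite ltr0n size_dJR_word_gt0.
have [_ mucyl] := hmu; have cle := dJR_freq_block_le k hmu q0.
have c0 : 0 <= dJR_freq R a b (tower_block a b q k).
  by rewrite -lee_fin -(mucyl 0).
rewrite /tower_level bigcup_mkord; apply: le_trans (Boole_inequality _ _) _.
  by move=> i _; exact: measurable_tower_cylinder.
rewrite (eq_bigr (fun=> (dJR_freq R a b (tower_block a b q k))%:E)) => [|i _]; last exact: mucyl.
rewrite sumEFin sumr_const card_ord lee_fin -[X in X <= _]mulr_natl.
apply: ler_pM => //; first by rewrite ler_nat tower_width_le.
by rewrite -div1r ler_pdivlMr // mulrC.
Qed.

(** The levels without mismatch are inside the cylinder or disjoint from it.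
    There are at most 3 l q |B_k| other levels, each of measure at most
    q / |B_{k+1}|, which is small because |B_{k+1}| >= b^{k+1} |B_k|. *)
Lemma cylinder_approximable (R : realType) a b (ha : (1 <= a <= b - 1)%N)
    (mu : probability (dJR_space ha) R) q j beta : is_dJR_measure mu -> (0 < q)%N ->
  approximable mu (level_unions ha q) (cylinder ha j beta).
Proof.
move=> hmu q0; split; first exact: measurable_cylinder.
move=> eps e0; have e2 : 0 < eps / 2 by rewrite divr_gt0.
pose l := size beta.
have near_res := residual_lt hmu q0 e2.
have near_bad := near_expn_lt (dJR_param ha) (ler0n R (l * q * 3 * q)) e2.
have near_win : \forall k \near \oo, (absz j + l <= k)%N by exact: nbhs_infty_ge.
apply: filterS3 near_res near_bad near_win => k res bad win.
pose W := dJR_word a b k.+1; pose H := tower_height a b q k.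
pose P m := mkseq (fun s =>
  cyclic_nth W (absz (j + s%:Z + (size W)%:Z)%R + q * m)) l == beta.
pose J := [set m | (m < H)%N /\ P m].
exists (\bigcup_(m in J) tower_level ha q k m).
  by exists J => // m [].
pose F m := if bad_level a b q k j l m == 0%N then set0 else tower_level ha q k m.
have mF m : measurable (F m).
  by rewrite /F; case: ifP => // _; exact: measurable_tower_level.
have mJ : measurable (\bigcup_(m in J) tower_level ha q k m).
  by apply: bigcup_measurable => m _; exact: measurable_tower_level.
rewrite (splitr eps).
apply: (@measure_cover2_lt _ _ _ _ _ (~` tower_union ha q k)
   (\bigcup_(m in `I_H) F m)) => //.
- by apply: measurable_symdiff => //; exact: measurable_cylinder.
- by apply: measurableC; exact: measurable_tower_union.
- exact: bigcup_measurable.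
- have good m x : (m < H)%N -> tower_level ha q k m x ->
     bad_level a b q k j l m = 0%N -> cylinder ha j beta x <-> P m.
    move=> mH xm b0; rewrite /P.
    rewrite (_ : mkseq _ _ = block (val x) j l); first by split=> [->|/eqP].
    apply: (@eq_from_nth _ false); rewrite ?size_mkseq // => s sl.
    by rewrite !nth_mkseq // (good_level_val q0 win mH sl b0 xm).
  move=> x [[xC nJ]|[[m [mH Pm] xm] nC]].
    have [[m mH xm]|nU] := pselect (tower_union ha q k x); last by left.
    right; exists m => //; rewrite /F; case: eqP => // b0.
    by apply: nJ; exists m => //; split=> //; exact/(good _ _ mH xm b0).
  right; exists m => //; rewrite /F; case: eqP => // b0.
  by apply: nC; exact/(good _ _ mH xm b0).
- apply: (@le_lt_trans _ _ ((l * q * 3 * q)%:R / (b ^ k.+1)%:R)%:E%E); last first.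
    by rewrite lte_fin; exact: bad.
  rewrite bigcup_mkord; apply: le_trans (Boole_inequality _ _) _ => //.
  pose r : R := q%:R / (size W)%:R.
  have r0 : 0 <= r by rewrite divr_ge0.
  apply: (@le_trans _ _ (\sum_(m < H) ((bad_level a b q k j l m)%:R * r)%:E)%E).
    apply: lee_sum => m _; rewrite /F; case: eqP => [->|/eqP b0].
      by rewrite measure0 mul0r.
    apply: le_trans (measure_tower_level_le k m hmu q0) _; rewrite lee_fin.
    by rewrite -/W -/r ler_peMl // ler1n lt0n.
  rewrite sumEFin lee_fin -mulr_suml -natr_sum.
  have hk : 0 < (size (dJR_word a b k))%:R :> R by rewrite ltr0n size_dJR_word_gt0.
  have bk : 0 < (b ^ k.+1)%:R :> R by rewrite ltr0n expn_gt0 (ltnW (dJR_param ha)).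
  have hW : (b ^ k.+1)%:R * (size (dJR_word a b k))%:R <= (size W)%:R :> R.
    by rewrite -natrM ler_nat /W size_dJR_wordS // leq_addr.
  have hW0 : 0 < (size W)%:R :> R by apply: lt_le_trans hW; rewrite mulr_gt0.
  apply: (@le_trans _ _ ((l * (q * (3 * size (dJR_word a b k))))%:R * r)).
    by rewrite ler_wpM2r // ler_nat sum_bad_level.
  rewrite /r mulrA ler_pdivrMr // mulrAC ler_pdivlMr //.
  rewrite !natrM; have l0 : 0 <= l%:R * q%:R * 3 * q%:R :> R by rewrite !mulr_ge0.
  apply: le_trans (ler_wpM2l l0 hW); rewrite le_eqVlt; apply/orP; left; apply/eqP.
  by rewrite -natrM; ring.
Qed.

Theorem theorem3p3 (R : realType) (a b : nat) (hb : (2 <= b)%N)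
    (ha : (1 <= a <= b - 1)%N) (mu : probability (dJR_space ha) R)
    (hmu : is_dJR_measure mu) (q : nat) (hq : (1 <= q)%N) :
  rank_one mu (iter q (dJR_map ha)).
Proof.
split; first by apply: measure_preserving_iter; have [] := hmu.
move=> n P eps mP _ _ e0.
have approx A : measurable A -> approximable mu (level_unions ha q) A.
  move=> mA; suff sub : <<s cylinders ha >> `<=` approximable mu (level_unions ha q) by exact: sub.
  apply: smallest_sub.
    apply: sigma_algebra_approximable.
    - move=> k _ [J _ ->]; apply: bigcup_measurable => m _.
      exact: measurable_tower_level.
    - by move=> k; exists set0 => //; rewrite bigcup_set0.
    - move=> k _ _ [J JH ->] [J' JH' ->]; exists (J `|` J'); last by rewrite bigcup_setU.
      by move=> m [/JH|/JH'].
    - move=> e e_gt0; have := residual_lt hmu hq e_gt0.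
      apply: filterS => k res _ [J JH ->].
      exists (\bigcup_(m in `I_(tower_height a b q k) `\` J) tower_level ha q k m).
        by exists (`I_(tower_height a b q k) `\` J) => // m [].
      apply: le_lt_trans res; rewrite le_measure ?inE//.
      + apply: measurable_symdiff; first apply: measurableC; apply: bigcup_measurable => m _;
        exact: measurable_tower_level.
      + by apply: measurableC; exact: measurable_tower_union.
      + move=> x [[nJ nJ']|[[m [mH nJm] xm] /contrapT[m' Jm' xm']]].
          move=> [m mH xm]; have [Jm|nJm] := pselect (J m).
            by apply: nJ; exists m.
          by apply: nJ'; exists m.
        exfalso; apply: nJm.
        by rewrite (trivIset_tower_level hq mH (JH _ Jm') (ex_intro _ x (conj xm xm'))).
  by move=> _ [j [beta ->]]; exact: cylinder_approximable.
have all_P : \forall k \near \oo, forall i : 'I_n,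
    exists2 U, level_unions ha q k U & (mu (P i `+` U) < eps%:E)%E.
  by apply: filter_forall => i; have [_] := approx _ (mP i); apply.
have [k [Pk res]] := filter_ex (filterI all_P (residual_lt hmu hq e0)).
exists (tower_level ha q k 0), (tower_height a b q k) => /=.
rewrite (_ : level _ _ = tower_level ha q k); last by apply/funext => m; exact: level_tower.
split=> //.
- exact: measurable_tower_level.
- exact: tower_height_gt0.
- exact: trivIset_tower_level.
- move=> i; have [_ [J JH ->] PJ] := Pk i.
  by exists J, false; rewrite setU0.
Qed.
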